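(* Let $\mathbb{F}_q$ be a finite field of odd characteristic. Suppose $\mathbb{F}_{q^2}=\mathbb{F}_q(\sqrt{c})$ for some $c\in\mathbb{F}_q^\times\setminus(\mathbb{F}_q^\times)^2$ and let $\sigma\in\mathrm{Gal}(\mathbb{F}_{q^2}/\mathbb{F}_q)$ be nontrivial. Then the distinct isomorphism classes of the nonassociative quaternion algebras with nucleus $\mathbb{F}_{q^2}$ are represented by $(\mathbb{F}_{q^2}/\mathbb{F}_q,\sigma,a)$, where $a$ is chosen from the set $$\mathcal{S}_2(\mathbb{F}_{q^2})=\{\sqrt{c},\ 1+s\sqrt{c}\mid s\in\mathbb{F}_q^\times/\{\pm1\}\}.$$ Alternatively, these distinct isomorphism classes can be parametrized by the elements $a$ of the set $$\mathcal{S}'(\mathbb{F}_{q^2})=\{t+\sqrt{c}\mid t\in\{0\}\cup\mathbb{F}_q^\times/\{\pm1\}\}.$$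
   Context: For $a\in\mathbb{F}_{q^2}\setminus\mathbb{F}_q$, the nonassociative quaternion algebra $(\mathbb{F}_{q^2}/\mathbb{F}_q,\sigma,a)$ is the Petit algebra $R/R(t^2-a)$, where $R=\mathbb{F}_{q^2}[t;\sigma]$ is the twisted polynomial ring with $tx=\sigma(x)t$: the $\mathbb{F}_q$-vector space of polynomials of degree $<2$ with product $g\circ h$ equal to the remainder $r$ in the right division $gh=q'(t^2-a)+r$, $\deg r<2$. The nucleus of an algebra $A$ is $\{x\in A: [x,A,A]=[A,x,A]=[A,A,x]=0\}$ with $[x,y,z]=(xy)z-x(yz)$. Here $\mathbb{F}_q^\times/\{\pm1\}$ stands for a fixed set of representatives of the cosets of $\{\pm1\}$ in $\mathbb{F}_q^\times$. Isomorphism means $\mathbb{F}_q$-algebra isomorphism; ''represented by'' means each isomorphism class contains exactly one algebra $(\mathbb{F}_{q^2}/\mathbb{F}_q,\sigma,a)$ with $a$ in the given set. *)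

(* Defs.v *)
From HB Require Import structures.
From mathcomp Require Import all_boot all_order all_algebra all_fingroup all_field.
From mathcomp Require Import zify.

Set Implicit Arguments.
Unset Strict Implicit.
Unset Printing Implicit Defensive.

Import GRing.Theory.
Local Open Scope ring_scope.

(* A twisted polynomial \sum_i x_i t^i of K[t; s], coefficients on the left,  *)
(* is encoded by the element \sum_i x_i 'X^i of {poly K}; only the additive   *)
(* structure of {poly K} is shared with K[t; s].                              *)
Section TwistedPoly.

Variables (K : fieldType) (s : K -> K).
Implicit Types f g p q : {poly K}.

(* The biadditive extension of (x t^i) (y t^j) = x s^i(y) t^(i+j).            *)
Definition twist_mul p q : {poly K} :=
  \sum_(i < size p) \sum_(j < size q) (p`_i * iter i s q`_j) *: 'X^(i + j).

(* Right division of g by f, i.e. with the divisor on the right:              *)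
(* the leading term of g is killed by a left multiple x t^k f. The first      *)
(* argument bounds the number of steps.                                       *)
Fixpoint twist_rem_loop (n : nat) f g : {poly K} :=
  if n isn't n'.+1 then g
  else if (size g < size f)%N then g
  else let k := (size g - size f)%N in
       let x := lead_coef g / iter k s (lead_coef f) in
       twist_rem_loop n' f (g - twist_mul (x *: 'X^k) f).

Definition twist_rem f g : {poly K} := twist_rem_loop (size g) f g.

End TwistedPoly.

Section TwistedPolyTheory.

Variables (K : fieldType) (s : {rmorphism K -> K}).
Implicit Types f g p q : {poly K}.

Fact iter_is_zmod_morphism i : zmod_morphism (iter i s).
Proof. by elim: i => [|i IHi] x y //=; rewrite IHi rmorphB. Qed.

Fact iter_is_monoid_morphism i : monoid_morphism (iter i s).
Proof.
split; first by elim: i => [|i IHi] //=; rewrite IHi rmorph1.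
by elim: i => [|i IHi] x y //=; rewrite IHi rmorphM.
Qed.

HB.instance Definition _ i :=
  GRing.isZmodMorphism.Build K K (iter i s) (iter_is_zmod_morphism i).
HB.instance Definition _ i :=
  GRing.isMonoidMorphism.Build K K (iter i s) (iter_is_monoid_morphism i).

Lemma twist_mulE n p q : (size p <= n)%N ->
  twist_mul s p q = \sum_(i < n) p`_i *: (map_poly (iter i s) q * 'X^i).
Proof.
move=> le_p_n; rewrite /twist_mul.
rewrite (big_ord_widen n (fun i => \sum_(j < size q)
  (p`_i * iter i s q`_j) *: 'X^(i + j))) // big_mkcond /=.
apply: eq_bigr => i _; case: ltnP => [_|le_p_i]; last first.
  by rewrite nth_default ?scale0r.
rewrite /map_poly poly_def mulr_suml scaler_sumr.
apply: eq_bigr => j _.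
by rewrite -scalerAl scalerA -exprD addnC.
Qed.

Lemma twist_mulDl p1 p2 q :
  twist_mul s (p1 + p2) q = twist_mul s p1 q + twist_mul s p2 q.
Proof.
pose n := maxn (size p1) (size p2).
rewrite !(@twist_mulE n) ?leq_maxl ?leq_maxr //; last first.
  exact: size_polyD.
rewrite -big_split /=; apply: eq_bigr => i _.
by rewrite coefD scalerDl.
Qed.

Lemma twist_mulDr p q1 q2 :
  twist_mul s p (q1 + q2) = twist_mul s p q1 + twist_mul s p q2.
Proof.
rewrite !(@twist_mulE (size p)) // -big_split /=; apply: eq_bigr => i _.
by rewrite rmorphD mulrDl scalerDr.
Qed.

Lemma twist_mulNl p q : twist_mul s (- p) q = - twist_mul s p q.
Proof.
rewrite !(@twist_mulE (size p)) ?size_polyN // -sumrN.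
by apply: eq_bigr => i _; rewrite coefN scaleNr.
Qed.

Lemma twist_mul0l q : twist_mul s 0 q = 0.
Proof. by rewrite /twist_mul size_poly0 big_ord0. Qed.

Lemma twist_mulZXn x k q :
  twist_mul s (x *: 'X^k) q = x *: (map_poly (iter k s) q * 'X^k).
Proof.
rewrite (@twist_mulE k.+1); last first.
  by rewrite (leq_trans (size_scale_leq _ _)) ?size_polyXn.
rewrite big_ord_recr /= big1 ?add0r => [|i _]; rewrite coefZ coefXn.
  by rewrite eqxx mulr1.
by rewrite ltn_eqF ?ltn_ord // mulr0 scale0r.
Qed.

(* The defining relation t x = s(x) t.                                        *)
Lemma twist_mulXC x : twist_mul s 'X x%:P = (s x)%:P * 'X.
Proof. by have:= twist_mulZXn 1 1 x%:P; rewrite !scale1r expr1 map_polyC. Qed.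

Lemma twist_mulA p q g :
  twist_mul s p (twist_mul s q g) = twist_mul s (twist_mul s p q) g.
Proof.
have sumr (I : Type) (r : seq I) (h : I -> {poly K}) u :
    twist_mul s u (\sum_(i <- r) h i) = \sum_(i <- r) twist_mul s u (h i).
  elim: r => [|i r IHr]; last by rewrite !big_cons twist_mulDr IHr.
  by rewrite !big_nil /twist_mul size_poly0 big1 // => i; rewrite big_ord0.
have suml (I : Type) (r : seq I) (h : I -> {poly K}) u :
    twist_mul s (\sum_(i <- r) h i) u = \sum_(i <- r) twist_mul s (h i) u.
  elim: r => [|i r IHr]; first by rewrite !big_nil twist_mul0l.
  by rewrite !big_cons twist_mulDl IHr.
have polyS (u : {poly K}) : u = \sum_(i < size u) u`_i *: 'X^i by rewrite -[LHS]coefK poly_def.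
rewrite [p]polyS (suml _ _ _ q) (suml _ _ _ g) (suml _ _ _ (twist_mul s q g)).
apply: eq_bigr => i _; move: (p`_i) => x.
rewrite [q]polyS (suml _ _ _ g) (sumr _ _ _ (x *: 'X^i)).
rewrite (sumr _ _ _ (x *: 'X^i)) (suml _ _ _ g).
apply: eq_bigr => j _; move: (q`_j) => y.
rewrite [g]polyS (sumr _ _ _ (y *: 'X^j)) (sumr _ _ _ (x *: 'X^i)).
rewrite (sumr _ _ _ (twist_mul s _ _)); apply: eq_bigr => k _.
rewrite !(twist_mulZXn, map_polyZ, map_polyXn, rmorphM) /=.
rewrite -!scalerAl -!exprD !scalerA.
rewrite !(twist_mulZXn, map_polyZ, map_polyXn, rmorphM) /=.
rewrite -!scalerAl -!exprD !scalerA -addnA.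
by rewrite [(j + i)%N]addnC iterD.
Qed.

Lemma size_twist_mulZXn x k f : x != 0 -> f != 0 ->
  size (twist_mul s (x *: 'X^k) f) = (k + size f)%N.
Proof.
move=> x0 f0; rewrite twist_mulZXn size_scale // size_mulXn.
  by rewrite size_map_poly.
by rewrite map_poly_eq0.
Qed.

Lemma lead_coef_twist_mulZXn x k f :
  lead_coef (twist_mul s (x *: 'X^k) f) = x * iter k s (lead_coef f).
Proof.
rewrite twist_mulZXn lead_coefZ lead_coef_Mmonic ?monicXn //.
by rewrite lead_coef_map.
Qed.

Lemma twist_rem_loopP n f g : f != 0 -> (size g <= n)%N ->
  (size (twist_rem_loop s n f g) < size f)%N /\
  exists q, g = twist_mul s q f + twist_rem_loop s n f g.
Proof.
move=> f0; have sf : (0 < size f)%N by rewrite size_poly_gt0.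
elim: n g => [|n IHn] g le_g /=.
  split; first exact: leq_ltn_trans le_g sf.
  by exists 0; rewrite twist_mul0l add0r.
case: (ltnP (size g) (size f)) => [lt_g|le_f].
  by split=> //; exists 0; rewrite twist_mul0l add0r.
set k := (size g - size f)%N; set x := _ / _; set u := twist_mul s _ f.
have g0 : g != 0 by rewrite -size_poly_gt0 (leq_trans sf).
have lf0 : iter k s (lead_coef f) != 0 by rewrite fmorph_eq0 lead_coef_eq0.
have x0 : x != 0 by rewrite mulf_neq0 ?invr_neq0 ?lead_coef_eq0.
have su : size u = size g by rewrite size_twist_mulZXn // subnK.
have lu : lead_coef u = lead_coef g by rewrite lead_coef_twist_mulZXn divfK.
have lt_gu : (size (g - u)%R < size g)%N.
  rewrite -[X in (_ < X)%N]prednK ?size_poly_gt0 // ltnS.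
  apply/leq_sizeP => j; rewrite leq_eqVlt => /predU1P[<-|lt_j].
    by rewrite coefB -[_`_ _ in X in X - _]lead_coefE -lu lead_coefE su subrr.
  rewrite prednK ?size_poly_gt0 // in lt_j.
  by rewrite coefB !nth_default ?su ?subrr.
have [|lt_r [q def_gu]] := IHn (g - u); first by rewrite -ltnS (leq_trans lt_gu).
split=> //; exists (x *: 'X^k + q).
by rewrite twist_mulDl -addrA -def_gu addrC subrK.
Qed.

Lemma twist_remP f g : f != 0 ->
  (size (twist_rem s f g) < size f)%N /\
  exists q, g = twist_mul s q f + twist_rem s f g.
Proof. by move=> f0; apply: twist_rem_loopP. Qed.

Lemma size_twist_mul_ge q f : q != 0 -> (size f <= size (twist_mul s q f))%N.
Proof.
move=> q0; have [->|f0] := eqVneq f 0; first by rewrite size_poly0.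
have sq : (0 < size q)%N by rewrite size_poly_gt0.
have sf : (0 < size f)%N by rewrite size_poly_gt0.
have: (twist_mul s q f)`_((size q).-1 + (size f).-1) != 0.
  rewrite (@twist_mulE (size q).-1.+1) ?leqSpred // coef_sum big_ord_recr /=.
  rewrite big1 => [|i _]; rewrite coefZ coefMXn.
    rewrite add0r ltnNge leq_addr /= addKn coef_map /= -!lead_coefE.
    by rewrite mulf_neq0 ?fmorph_eq0 ?lead_coef_eq0.
  case: ltnP => _; rewrite ?mulr0 // coef_map /= [f`_(_ - _)]nth_default.
    by rewrite rmorph0 mulr0.
  by case: i => i /= lt_i; lia.
apply: contraNT; rewrite -ltnNge => lt_s; apply/eqP/nth_default.
move: (size (twist_mul _ _ _)) lt_s => n lt_s; lia.
Qed.

Lemma twist_rem_uniq f g q r : f != 0 -> g = twist_mul s q f + r ->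
  (size r < size f)%N -> r = twist_rem s f g.
Proof.
move=> f0 def_g lt_r; have [lt_r' [q']] := twist_remP g f0.
set r' := twist_rem s f g in lt_r' * => def_g'.
have eq_r : twist_mul s (q - q') f = r' - r.
  rewrite twist_mulDl twist_mulNl; apply/eqP.
  by rewrite subr_eq addrAC eq_sym subr_eq addrC -def_g' def_g addrC.
have [q0|/size_twist_mul_ge le_f] := eqVneq (q - q') 0.
  move: eq_r; rewrite q0 twist_mul0l => /esym/eqP.
  by rewrite subr_eq0 => /eqP.
have := le_f f; rewrite eq_r leqNgt (leq_ltn_trans (size_polyD _ _)) //.
by rewrite size_polyN gtn_max lt_r lt_r'.
Qed.

End TwistedPolyTheory.

Section Algebras.

Variable F : fieldType.

Definition in_nucleus (V : zmodType) (mul : V -> V -> V) (x : V) : Prop :=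
  let assoc u v w := mul (mul u v) w - mul u (mul v w) in
  forall y z, [/\ assoc x y z = 0, assoc y x z = 0 & assoc y z x = 0].

Definition alg_isom (V W : lmodType F)
    (mulV : V -> V -> V) (mulW : W -> W -> W) : Prop :=
  exists h : {linear V -> W},
    bijective h /\ {morph h : x y / mulV x y >-> mulW x y}.

Variable L : fieldExtType F.

(* The F-space of twisted polynomials of degree < deg f; F acts on the left.  *)
(* {poly_n L} only carries an L-space structure.                              *)
Definition petit (f : {poly L}) : Type := {poly_((size f).-1) L}.

HB.instance Definition _ f :=
  GRing.Zmodule.copy (petit f) {poly_((size f).-1) L}.

Section Scaling.

Variable f : {poly L}.
Implicit Types (a b : F) (u v : petit f).

Definition petit_scale a u : petit f :=
  (a%:A : L) *: (u : {poly_((size f).-1) L}).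

Fact petit_scaleA a b v :
  petit_scale a (petit_scale b v) = petit_scale (a * b) v.
Proof. by rewrite /petit_scale scalerA -scalerAl mul1r scalerA. Qed.

Fact petit_scale1 : left_id 1 petit_scale.
Proof. by move=> v; rewrite /petit_scale !scale1r. Qed.

Fact petit_scaleDr : right_distributive petit_scale +%R.
Proof. by move=> a u v; rewrite /petit_scale scalerDr. Qed.

Fact petit_scaleDl v : {morph petit_scale^~ v : a b / a + b}.
Proof. by move=> a b; rewrite /petit_scale !scalerDl. Qed.

HB.instance Definition _ := GRing.Zmodule_isLmodule.Build F (petit f)
  petit_scaleA petit_scale1 petit_scaleDr petit_scaleDl.

End Scaling.

(* npolyp truncates, which is harmless by twist_remP: see petit_mulP.         *)
Definition petit_mul (s : L -> L) (f : {poly L}) (g h : petit f) : petit f :=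
  npolyp (size f).-1
    (twist_rem s f (twist_mul s (polyn g) (polyn h))).

Lemma petit_mulP (s : {rmorphism L -> L}) f (g h : petit f) : f != 0 ->
  exists q, twist_mul s (polyn g) (polyn h)
            = twist_mul s q f + polyn (petit_mul s g h).
Proof.
move=> f0; have [lt_r [q def_gh]] := twist_remP s
  (twist_mul s (polyn g) (polyn h)) f0.
exists q; rewrite npolypK // -ltnS prednK ?size_poly_gt0 //.
Qed.

End Algebras.

Section NonassociativeQuaternion.

Variables (F : fieldType) (L : fieldExtType F) (s : L -> L).

Definition nquat (a : L) : lmodType F := petit ('X^2 - a%:P).

Definition nquat_mul (a : L) : nquat a -> nquat a -> nquat a :=
  @petit_mul F L s ('X^2 - a%:P).

(* a \notin F, and the nucleus is L, viewed as the constant polynomials.      *)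
Definition is_nquat_nucleus (a : L) : Prop :=
  a \notin 1%VS /\
  forall x : nquat a,
    in_nucleus (@nquat_mul a) x <-> (size (polyn x) <= 1)%N.

Definition nquat_isom (a b : L) : Prop :=
  alg_isom (@nquat_mul a) (@nquat_mul b).

(* The nonassociative quaternion algebras with nucleus L are, up to           *)
(* isomorphism and without repetition, the ones with a in S.                  *)
Definition represents_nquat (S : pred L) : Prop :=
  (forall a, a \in S -> is_nquat_nucleus a) /\
  (forall a, is_nquat_nucleus a ->
     exists! b, b \in S /\ nquat_isom a b).

End NonassociativeQuaternion.

(* T consists of one element of each coset {x, -x} of {1, -1} in F^*.         *)
Definition sign_representatives (F : finFieldType) (T : {set F}) : bool :=
  is_transversal T [set [set x; - x] | x in [set~ 0]] [set~ 0].

Section ParameterSets.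

Variables (F : finFieldType) (L : fieldExtType F) (r : L) (T : {set F}).

Definition set_S2 : pred L :=
  [pred a | (a == r) || [exists s in T, a == 1 + s *: r]].

Definition set_S' : pred L :=
  [pred a | [exists t in 0 |: T, a == t%:A + r]].

End ParameterSets.

(* Main.v *)
Require Import Defs.
From HB Require Import structures.
From mathcomp Require Import all_boot all_order all_algebra all_fingroup all_field.
From mathcomp Require Import ring.

Set Implicit Arguments.
Unset Strict Implicit.
Unset Printing Implicit Defensive.

Import GRing.Theory.
Local Open Scope ring_scope.

(** Write K for the quadratic extension, s for its conjugation, N for its norm
and A(a) for the algebra attached to a.  On pairs of coefficients the product
of A(a) is
  (x0, x1) (y0, y1) = (x0 y0 + x1 s(y1) a, x0 y1 + x1 s(y0)),
and the associator [x, t, t] has t-coefficient x1 (a - s(a)).  Hence, when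
a is not in F, the nucleus of A(a) is exactly K ([nquat_in_nucleus]).

An isomorphism h from A(a) to A(b) preserves nuclei, so it induces an
automorphism tau of K.  The relation t x = s(x) t forces h(t) = k t for some
nonzero k, and applying h to t^2 = a gives tau(a) = N(k) b
([nquat_isom_norm]).  Conversely such tau and k define an isomorphism
([nquat_isom_of_norm]).

The norm of a quadratic extension of finite fields is onto: the sets
{x^2} and {n + c y^2} each have more than half as many elements as F, so they
meet ([norm_form_onto]).  As the automorphisms of K are 1 and s, the algebras
of u + v r and u' + v' r are therefore isomorphic if and only if
u / v = u' / v' up to sign, where r is the square root of c.  So the
isomorphism class is governed by (u / v)^2, a square of F which may vanish
([quad_nquat_isomP]).  In the second family the parameter t + r has ratio t;
in the first one r has ratio 0 and 1 + y r has ratio y^-1.  Both meet each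
value of (u / v)^2 once, because the squares of the elements of T are the
nonzero squares of F, each taken once ([sign_repr_exists],
[sign_repr_sqr_inj]). *)

(** * The product on coefficients *)

Section LinearTwistedProduct.

Variables (K : fieldType) (s : {rmorphism K -> K}).

(** Since t^2 = 1 (t^2 - a) + a, the quotient is the coefficient of t^2 and the
remainder replaces t^2 by a, on the right of that coefficient. *)
Lemma twist_rem_linear_mul (a : K) (p q : {poly K}) :
  (size p <= 2)%N -> (size q <= 2)%N ->
  twist_rem s ('X^2 - a%:P) (twist_mul s p q) =
    (p`_0 * q`_0 + p`_1 * s q`_1 * a)%:P + (p`_0 * q`_1 + p`_1 * s q`_0) *: 'X.
Proof.
move=> sp sq.
have f0 : 'X^2 - a%:P != 0 :> {poly K} by rewrite -size_poly_gt0 size_XnsubC.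
have defq : q = (q`_0)%:P + q`_1 *: 'X.
  apply/polyP => -[|[|i]]; rewrite coefD coefC coefZ coefX /= ?mulr0 ?addr0 //.
    by rewrite mulr1 add0r.
  by rewrite nth_default // (leq_trans sq).
apply/esym/(@twist_rem_uniq K s _ _ (p`_1 * s q`_1)%:P) => //; last first.
  rewrite size_XnsubC // ltnS (leq_trans (size_polyD _ _)) // geq_max.
  rewrite (leq_trans (size_polyC_leq1 _)) //.
  by rewrite (leq_trans (size_scale_leq _ _)) ?size_polyX.
have map_poly0iter (u : {poly K}) : map_poly (iter 0 s) u = u.
  by apply: map_poly_id.
rewrite (twist_mulE _ _ sp) (@twist_mulE _ _ 1) ?size_polyC_leq1 //.
rewrite !big_ord_recl !big_ord0 /= coefC -[bump 0 0]/1%N !map_poly0iter /=.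
move: (p`_0) (p`_1) (q`_0) (q`_1) defq => x y z w ->.
rewrite rmorphD /= map_polyC map_polyZ map_polyX /= -!mul_polyC.
rewrite !rmorphD !rmorphM /= expr0 expr1; ring.
Qed.

End LinearTwistedProduct.

Section Coordinates.

Variables (F : fieldType) (L : fieldExtType F).
Implicit Types (a x y : L).

Definition nquat_mk a x y : nquat a :=
  npolyp (size ('X^2 - a%:P)).-1 (x%:P + y *: 'X).

Definition nquat_co a (u : nquat a) i : L := (polyn u)`_i.

Lemma size_nquat a (u : nquat a) : (size (polyn u) <= 2)%N.
Proof. by apply: leq_trans (size_npoly u) _; rewrite size_XnsubC. Qed.

Lemma nquat_eqP a (u v : nquat a) :
  nquat_co u 0 = nquat_co v 0 -> nquat_co u 1 = nquat_co v 1 -> u = v.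
Proof.
move=> e0 e1; apply/val_inj/polyP => -[|[|i]] //=.
by rewrite !nth_default // (leq_trans (size_nquat _)).
Qed.

Lemma nquat_mk0 a x y : nquat_co (nquat_mk a x y) 0 = x.
Proof.
rewrite /nquat_co coef_npolyp size_XnsubC // coefD coefC coefZ coefX.
by rewrite mulr0 addr0.
Qed.

Lemma nquat_mk1 a x y : nquat_co (nquat_mk a x y) 1 = y.
Proof.
rewrite /nquat_co coef_npolyp size_XnsubC // coefD coefC coefZ coefX.
by rewrite mulr1 add0r.
Qed.

Definition nquat_mkE := (nquat_mk0, nquat_mk1).

Lemma nquat_coD a (u v : nquat a) i :
  nquat_co (u + v) i = nquat_co u i + nquat_co v i.
Proof. exact: coefD. Qed.

Lemma nquat_coN a (u : nquat a) i : nquat_co (- u) i = - nquat_co u i.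
Proof. exact: coefN. Qed.

Lemma nquat_co0 a i : nquat_co (0 : nquat a) i = 0.
Proof. exact: coef0. Qed.

Lemma nquat_coZ a k (u : nquat a) i : nquat_co (k *: u) i = k%:A * nquat_co u i.
Proof. exact: coefZ. Qed.

Variable s : {lrmorphism L -> L}.

Lemma nquat_mulE a (u v : nquat a) :
  nquat_mul s u v =
  nquat_mk a (nquat_co u 0 * nquat_co v 0 + nquat_co u 1 * s (nquat_co v 1) * a)
             (nquat_co u 0 * nquat_co v 1 + nquat_co u 1 * s (nquat_co v 0)).
Proof.
by congr (npolyp _ _); apply: twist_rem_linear_mul; apply: size_nquat.
Qed.

Lemma nquat_mul_co0 a (u v : nquat a) :
  nquat_co (nquat_mul s u v) 0 =
    nquat_co u 0 * nquat_co v 0 + nquat_co u 1 * s (nquat_co v 1) * a.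
Proof. by rewrite nquat_mulE nquat_mk0. Qed.

Lemma nquat_mul_co1 a (u v : nquat a) :
  nquat_co (nquat_mul s u v) 1 =
    nquat_co u 0 * nquat_co v 1 + nquat_co u 1 * s (nquat_co v 0).
Proof. by rewrite nquat_mulE nquat_mk1. Qed.

Definition nquat_coE :=
  (nquat_mul_co0, nquat_mul_co1, nquat_coD, nquat_coN, nquat_co0, nquat_coZ,
   nquat_mk0, nquat_mk1).

(** * Nucleus and isomorphisms *)

Hypothesis sK : involutive s.

(** A constant x has vanishing associators because s is an involution: s(s(x))
appears when t is moved across x twice.  Conversely, the t-coefficient of
[x, t, t] is x1 (a - s(a)), which forces x1 = 0. *)
Lemma nquat_in_nucleus a (x : nquat a) : s a != a ->
  in_nucleus (@nquat_mul F L s a) x <-> nquat_co x 1 = 0.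
Proof.
move=> sa; split=> [nuc | x1 assoc y z].
  have [/(congr1 (fun u : nquat a => nquat_co u 1)) + _ _] :=
    nuc (nquat_mk a 0 1) (nquat_mk a 0 1).
  rewrite !nquat_coE !(rmorph0, rmorph1, rmorphD, rmorphM) => e.
  have : nquat_co x 1 * (a - s a) = 0 by rewrite -e; ring.
  by move/eqP; rewrite mulf_eq0 subr_eq0 [a == _]eq_sym (negPf sa) orbF => /eqP.
by rewrite {}/assoc; split; apply: nquat_eqP;
  rewrite !nquat_coE x1 !(rmorphD, rmorphM, rmorph0) /= ?sK; ring.
Qed.

Lemma is_nquat_nucleusP a : s a != a -> is_nquat_nucleus s a <-> a \notin 1%VS.
Proof.
move=> sa; split=> [[] // | aF]; split=> // x.
rewrite nquat_in_nucleus //; split=> [x1 | /leq_sizeP le1]; last exact: le1.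
apply/leq_sizeP => -[|[|i]] // _.
by rewrite nth_default // (leq_trans (size_nquat _)).
Qed.

(** The isomorphism is x0 + x1 t |-> tau(x0) + tau(x1) k t; that tau commutes
with s makes it compatible with t x = s(x) t. *)
Lemma nquat_isom_of_norm a b (tau : {lrmorphism L -> L}) (k : L) :
    involutive tau -> (forall x, tau (s x) = s (tau x)) ->
    k != 0 -> tau a = k * s k * b ->
  nquat_isom s a b.
Proof.
move=> tauK tauC k0 tau_a.
pose h (u : nquat a) : nquat b :=
  nquat_mk b (tau (nquat_co u 0)) (tau (nquat_co u 1) * k).
have h_lin : linear h.
  move=> x u v; apply: nquat_eqP; rewrite !nquat_coE !rmorphD !rmorphM /=;
    by rewrite rmorph_alg; ring.
pose hL := GRing.isLinear.Build F (nquat a) (nquat b) *:%R h h_lin.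
exists (HB.pack h hL : {linear nquat a -> nquat b}); split.
  exists (fun u => nquat_mk a (tau (nquat_co u 0)) (tau (nquat_co u 1 / k)))
    => u /=.
    by apply: nquat_eqP; rewrite !nquat_coE ?mulfK ?tauK.
  by apply: nquat_eqP; rewrite !nquat_coE ?tauK ?divfK.
move=> u v /=; apply: nquat_eqP; rewrite !nquat_coE !rmorphD !rmorphM /= !tauC.
  by rewrite tau_a; ring.
ring.
Qed.

(** An isomorphism maps the nucleus K of the first algebra to that of the
second, which yields tau; k is the t-coefficient of the image of t. *)
Lemma nquat_isom_norm a b : s a != a -> s b != b -> nquat_isom s a b ->
  exists tau : {lrmorphism L -> L}, exists2 k, k != 0 & tau a = k * s k * b.
Proof.
move=> sa sb [h [h_bij hM]].
have [g hK gK] := h_bij.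
have h_nuc x : nquat_co (h (nquat_mk a x 0)) 1 = 0.
  apply/(nquat_in_nucleus _ sb) => assoc y z.
  rewrite {}/assoc -(gK y) -(gK z) -!hM -!raddfB /=.
  have /(nquat_in_nucleus _ sa) : nquat_co (nquat_mk a x 0) 1 = 0.
    by rewrite nquat_mk1.
  by move=> /(_ (g y) (g z))[-> -> ->]; rewrite raddf0.
pose tau x := nquat_co (h (nquat_mk a x 0)) 0.
have hE x : h (nquat_mk a x 0) = nquat_mk b (tau x) 0.
  by apply: nquat_eqP; rewrite !nquat_mkE ?h_nuc.
have tau_lin : linear tau.
  move=> x u v; rewrite /tau.
  have -> : nquat_mk a (x *: u + v) 0 = x *: nquat_mk a u 0 + nquat_mk a v 0.
    by apply: nquat_eqP; rewrite !nquat_coE ?mulr_algl ?scaler0 ?addr0.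
  by rewrite linearP !nquat_coE mulr_algl.
have tauM : {morph tau : x y / x * y}.
  move=> x y; rewrite /tau.
  have -> : nquat_mk a (x * y) 0 =
      nquat_mul s (nquat_mk a x 0) (nquat_mk a y 0).
    by apply: nquat_eqP; rewrite !nquat_coE ?rmorph0; ring.
  by rewrite hM nquat_coE !h_nuc !mul0r addr0.
have tau_inj0 x : tau x = 0 -> x = 0.
  move=> tx; have : h (nquat_mk a x 0) = h 0.
    by rewrite hE tx raddf0; apply: nquat_eqP; rewrite !nquat_coE.
  move/(bij_inj h_bij)/(congr1 (fun u : nquat a => nquat_co u 0)).
  by rewrite !nquat_coE.
have tau1 : tau 1 = 1.
  have t0 : tau 1 != 0 by apply/eqP => /tau_inj0/eqP; rewrite oner_eq0.
  by apply: (mulfI t0); rewrite -tauM !mulr1.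
pose tauL := GRing.isLinear.Build F L L *:%R tau tau_lin.
pose tauR := GRing.isMonoidMorphism.Build L L tau (conj tau1 tauM).
pose T : {lrmorphism L -> L} := HB.pack tau tauL tauR.
have TE x : T x = tau x by [].
set t := nquat_mk a 0 1.
have tx x :
    nquat_mul s t (nquat_mk a x 0) = nquat_mul s (nquat_mk a (s x) 0) t.
  by apply: nquat_eqP; rewrite !nquat_coE ?rmorph0 ?rmorph1; ring.
(* Applied to x = a, the commutation rule says that the constant coefficient *)
(* of h(t) kills tau (a - s a), which is nonzero.                            *)
have u0 : nquat_co (h t) 0 = 0.
  have := congr1 (fun u => nquat_co (h u) 0) (tx a).
  rewrite !hM !hE !nquat_coE rmorph0 => /eqP.
  rewrite mulr0 !mul0r !addr0 mulrC -subr_eq0 -mulrBl -!TE -rmorphB mulf_eq0.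
  case/orP => /eqP // /tau_inj0/eqP; rewrite subr_eq0 eq_sym; exact/contraTeq.
have tt : nquat_mul s t t = nquat_mk a a 0.
  by apply: nquat_eqP; rewrite !nquat_coE ?rmorph0 ?rmorph1; ring.
exists T, (nquat_co (h t) 1) => [|]; last first.
  by rewrite TE /tau -tt hM nquat_coE u0 mul0r add0r.
apply/eqP => k0.
have /(congr1 (fun u : nquat b => nquat_co u 0)) := congr1 h tt.
rewrite hM hE !nquat_coE u0 k0 !mul0r addr0 => /esym/tau_inj0 a0.
by rewrite a0 rmorph0 eqxx in sa.
Qed.

End Coordinates.

(** * Quadratic extensions *)

Section QuadraticExtension.

Variables (F : fieldType) (L : fieldExtType F) (c : F) (r : L).
Hypothesis dimL : \dim {:L} = 2.
Hypothesis c_nonsquare : forall x : F, x ^+ 2 != c.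
Hypothesis r_sqrt : r ^+ 2 = c%:A.

Lemma sqrt_notin_base : r \notin 1%VS.
Proof.
apply/negP => /vlineP[k rk]; have /eqP[] := c_nonsquare k.
by apply: (fmorph_inj (in_alg L)); rewrite /= -r_sqrt rk exprZn expr1n.
Qed.

Lemma quad_coord (x : L) : exists u v : F, x = u%:A + v *: r.
Proof.
have rL : (1 + <[r]> == {:L})%VS.
  rewrite eqEdim subvf dimL dimv_disjoint_sum ?dimv1 ?dim_vline.
    suff -> : r != 0 by [].
    by apply: contraNneq sqrt_notin_base => ->; rewrite mem0v.
  apply/eqP; rewrite -subv0; apply/subvP => y; rewrite memv_cap memv0.
  case/andP => y1 /vlineP[k yk]; move: y1; rewrite yk.
  have [->|k0] := eqVneq k 0; first by rewrite scale0r.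
  by rewrite rpredZeq (negPf k0) (negPf sqrt_notin_base).
have : x \in (1 + <[r]>)%VS by rewrite (eqP rL) memvf.
by case/memv_addP => _ /vlineP[u ->] [_ /vlineP[v ->] ->]; exists u, v.
Qed.

Lemma quad_inj (u v u' v' : F) :
  u%:A + v *: r = u'%:A + v' *: r -> u = u' /\ v = v'.
Proof.
move=> e; have vv : v = v'.
  apply/eqP; rewrite -subr_eq0; apply: contraNT sqrt_notin_base => d0.
  apply/vlineP; exists ((v - v')^-1 * (u' - u)).
  apply: (scalerI d0); rewrite scalerA mulrA divff // mul1r scalerBl scalerBl.
  by apply/eqP; rewrite subr_eq addrAC eq_sym subr_eq -e addrC.
split=> //; apply: (fmorph_inj (in_alg L)) => /=.
by move: e; rewrite vv; apply: addIr.
Qed.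

Lemma quad_notin_base u v : (u%:A + v *: r \notin 1%VS) = (v != 0).
Proof.
congr (~~ _); apply/vlineP/eqP => [[k] | ->]; last first.
  by exists u; rewrite scale0r addr0.
by rewrite -[k *: 1]addr0 -[0 in RHS](scale0r r) => /quad_inj[].
Qed.

Variable s : {lrmorphism L -> L}.
Hypothesis s_r : s r = - r.
Hypothesis two_neq0 : 2%:R != 0 :> F.

Lemma quad_conj u v : s (u%:A + v *: r) = u%:A + (- v) *: r.
Proof. by rewrite linearD !linearZ /= rmorph1 s_r scalerN scaleNr. Qed.

Lemma quad_conjK : involutive s.
Proof.
by move=> x; have [u [v ->]] := quad_coord x; rewrite !quad_conj opprK.
Qed.

Lemma quad_norm u v : let x := u%:A + v *: r in
  x * s x = (u ^+ 2 - c * v ^+ 2)%:A.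
Proof.
rewrite /= quad_conj scaleNr scalerBl.
have -> : (c * v ^+ 2)%:A = r ^+ 2 * (v ^+ 2)%:A :> L.
  by rewrite r_sqrt mulr_algl scalerA.
have sqrA k : (k ^+ 2)%:A = k%:A ^+ 2 :> L by rewrite exprZn expr1n.
by rewrite !sqrA -(mulr_algl v r); move: (u%:A) (v%:A) => {}u {}v; ring.
Qed.

Lemma quad_conj_neq u v : v != 0 -> s (u%:A + v *: r) != u%:A + v *: r.
Proof.
move=> v0; apply/eqP; rewrite quad_conj => /quad_inj[_ /esym/eqP].
by rewrite -addr_eq0 -mulr2n -mulr_natl mulf_eq0 (negPf v0) (negPf two_neq0).
Qed.

(** * Classification by the squared ratio *)

Hypothesis norm_onto : forall n : F, exists u v : F, u ^+ 2 - c * v ^+ 2 = n.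

(** Multiplying by a norm from K, that is by any nonzero scalar, scales u and v
together, and conjugation changes the sign of v: up to sign, only the ratio
u / v survives. *)
Lemma quad_nquat_isomP u v u' v' : v != 0 -> v' != 0 ->
  nquat_isom s (u%:A + v *: r) (u'%:A + v' *: r) <->
    (u * v') ^+ 2 = (u' * v) ^+ 2.
Proof.
move=> v0 v'0; split=> [|/eqP].
  case/nquat_isom_norm; [exact: quad_conjK| exact: quad_conj_neq..|].
  move=> tau [k k0]; have [x [y ->]] := quad_coord k; rewrite quad_norm.
  set n := _ - _; rewrite mulr_algl linearD !linearZ /= rmorph1.
  have : (tau r) ^+ 2 = r ^+ 2 by rewrite -rmorphXn r_sqrt /= rmorph_alg.
  (* tau permutes the two square roots of c, and n = N(k) is a scalar. *)
  move/eqP; rewrite eqf_sqr scalerDr !scalerA.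
  case/orP=> /eqP -> ; rewrite ?scalerN -?scaleNr => /quad_inj[-> e].
    by rewrite e; ring.
  by rewrite -(opprK v) e; ring.
rewrite eqf_sqr => uv.
have [tau [e [tauK tauC tau_r e_sqr e_uv]]] :
  exists tau : {lrmorphism L -> L}, exists e : F,
    [/\ involutive tau, forall x, tau (s x) = s (tau x), tau r = e *: r,
        e ^+ 2 = 1 & u * v' = e * (u' * v)].
  case/orP: uv => /eqP uv.
    by exists idfun, 1; split; rewrite ?scale1r ?mul1r ?expr1n.
  exists s, (-1); split; rewrite ?scaleN1r ?mulN1r ?sqrrN ?expr1n //.
  exact: quad_conjK.
have e0 : e != 0 by rewrite -sqrf_eq0 e_sqr oner_eq0.
(* The r-coefficients of tau a = N(k) b impose N(k) = e v / v'. *)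
have [x [y nE]] := norm_onto (e * v / v').
apply: (@nquat_isom_of_norm _ _ _ _ _ tau (x%:A + y *: r)) => //.
  apply/eqP => k0; have := quad_norm x y; rewrite /= k0 mul0r nE => /esym/eqP.
  rewrite scaler_eq0 oner_eq0 orbF !mulf_eq0 invr_eq0.
  by rewrite (negPf e0) (negPf v0) (negPf v'0).
rewrite quad_norm nE mulr_algl linearD !linearZ /= rmorph1 tau_r.
rewrite scalerDr !scalerA divfK // [e * v]mulrC; congr (_%:A + _).
by apply: (mulIf v'0); rewrite e_uv; field.
Qed.

(** Reduces the classification to equations between scalars of F.  The ratios are
compared by cross products, so that both families fit without division. *)
Lemma represents_nquat_quad (S : pred L) :
    (forall a, a \in S -> a \notin 1%VS) ->
    (forall u v, v != 0 -> exists u' v',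
       [/\ u'%:A + v' *: r \in S, v' != 0 & (u * v') ^+ 2 = (u' * v) ^+ 2]) ->
    (forall u v u' v', u%:A + v *: r \in S -> u'%:A + v' *: r \in S ->
       (u * v') ^+ 2 = (u' * v) ^+ 2 -> u = u' /\ v = v') ->
  represents_nquat s S.
Proof.
move=> SnF Sex Suniq.
have nucP u v : v != 0 -> is_nquat_nucleus s (u%:A + v *: r).
  move=> v0; apply/is_nquat_nucleusP; rewrite ?quad_notin_base //.
    exact: quad_conjK.
  exact: quad_conj_neq.
split=> [a aS | a [aF _]].
  have := SnF a aS; have [u [v ->]] := quad_coord a.
  by rewrite quad_notin_base; apply: nucP.
move: aF; have [u [v ->]] := quad_coord a; rewrite quad_notin_base => v0.
have [u' [v' [bS v'0 uv]]] := Sex u v v0.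
exists (u'%:A + v' *: r); split; first by split=> //; apply/quad_nquat_isomP.
move=> b' [b'S]; have := SnF b' b'S; have [x [y eb]] := quad_coord b'.
rewrite eb quad_notin_base => y0 /quad_nquat_isomP; rewrite eb in b'S.
move=> /(_ v0 y0) xy; have [|-> -> //] := Suniq _ _ _ _ bS b'S.
apply: (mulIf (expf_neq0 2 v0)).
transitivity ((u' * v) ^+ 2 * y ^+ 2); first by ring.
rewrite -uv; transitivity ((u * y) ^+ 2 * v' ^+ 2); first by ring.
by rewrite xy; ring.
Qed.

End QuadraticExtension.

(** * Representatives modulo sign and the norm form *)

Section SignRepresentatives.

Variables (F : finFieldType) (T : {set F}).
Hypothesis T_repr : sign_representatives T.

Lemma sign_repr_neq0 x : x \in T -> x != 0.
Proof.
by move=> xT; have /subsetP/(_ x xT) := transversal_sub T_repr; rewrite !inE.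
Qed.

Lemma sign_repr_card x : x != 0 -> #|T :&: [set x; - x]| = 1.
Proof.
move=> x0; have /and3P[_ _ /forall_inP T1] := T_repr.
by apply/eqP/T1/imset_f; rewrite !inE.
Qed.

Lemma sign_repr_exists x : exists2 t, t \in 0 |: T & t ^+ 2 = x ^+ 2.
Proof.
have [->|x0] := eqVneq x 0; first by exists 0; rewrite ?setU11.
have /eqP/cards1P[t Tt] := sign_repr_card x0.
have : t \in T :&: [set x; - x] by rewrite Tt set11.
rewrite !inE => /andP[tT /pred2P tx]; exists t; first by rewrite !inE tT orbT.
by case: tx => ->; rewrite ?sqrrN.
Qed.

Lemma sign_repr_sqr_inj : {in 0 |: T &, injective (fun t => t ^+ 2)}.
Proof.
move=> x y; rewrite !in_setU1.
have sqr0 (z : F) : 0 ^+ 2 = z ^+ 2 -> 0 = z.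
  by move/esym/eqP; rewrite expr0n sqrf_eq0 => /eqP.
case/predU1P=> [-> _ /sqr0 //| xT]; case/predU1P=> [-> /esym/sqr0 //| yT /eqP].
rewrite eqf_sqr => xy.
have /eqP/cards1P[t Tt] := sign_repr_card (sign_repr_neq0 yT).
have : y \in [set t] by rewrite -Tt !inE yT eqxx.
have : x \in [set t] by rewrite -Tt !inE xT xy.
by rewrite !inE => /eqP-> /eqP->.
Qed.

(** P, the set T with 0 added, and its opposite cover F and share 0, so P has
more than half of the elements of F.  Squaring is injective on P, hence the
squares and the elements n + c y^2 cannot form disjoint sets. *)
Lemma norm_form_onto c n : c != 0 -> exists u v : F, u ^+ 2 - c * v ^+ 2 = n.
Proof.
move=> c0; set P := 0 |: T.
pose A := [set x ^+ 2 | x in P]; pose B := [set n + c * y ^+ 2 | y in P].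
have cA : #|A| = #|P| by apply: card_in_imset sign_repr_sqr_inj.
have cB : #|B| = #|P|.
  apply: card_in_imset => x y xP yP /addrI/(mulfI c0); exact: sign_repr_sqr_inj.
have cF : (#|F| < #|A| + #|B|)%N.
  rewrite cA cB -{2}(card_imset (mem P) (@oppr_inj F)) -cardsUI.
  rewrite -[X in (X < _)%N]addn0.
  rewrite -addnS leq_add //; last first.
    by apply/card_gt0P; exists 0; rewrite inE setU11 -[0]oppr0 imset_f ?setU11.
  rewrite -cardsT; apply/subset_leq_card/subsetP => x _.
  have [t tP /eqP] := sign_repr_exists x; rewrite eqf_sqr.
  case/orP => /eqP; first by move=> <-; rewrite inE tP.
  by move=> tx; rewrite inE -(opprK x) -tx (imset_f _ tP) orbT.
have /set0Pn[z] : A :&: B != set0.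
  rewrite -card_gt0 -(ltn_add2l #|A :|: B|) addn0 cardsUI.
  exact: leq_ltn_trans (max_card _) cF.
rewrite inE => /andP[/imsetP[u _ ->] /imsetP[v _ e]].
by exists u, v; rewrite e addrK.
Qed.

End SignRepresentatives.

(** * The two families of representatives *)

Theorem theorem5p2 (F : finFieldType) (p : nat) (L : splittingFieldType F)
    (c : F) (r : L) (sigma : gal_of {:L}) (T : {set F})
    (hp : p \in [pchar F]) (p_odd : odd p)
    (dimL : \dim {:L} = 2%N)
    (c_neq0 : c != 0) (c_nonsquare : forall x : F, x ^+ 2 != c)
    (r_sqrt : r ^+ 2 = c%:A) (L_gen : <<1; r>>%VS = {:L}%VS)
    (sigma_gal : sigma \in 'Gal({:L} / 1)%g) (sigma_neq1 : sigma != 1%g)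
    (T_repr : sign_representatives T) :
  represents_nquat sigma (set_S2 r T) /\ represents_nquat sigma (set_S' r T).
Proof.
have two_neq0 : 2%:R != 0 :> F.
  rewrite -(dvdn_pcharf hp); apply: contraL p_odd.
  by rewrite dvdn_prime2 ?(pcharf_prime hp) // => /eqP->.
have coords := quad_coord dimL c_nonsquare r_sqrt.
have inj := quad_inj c_nonsquare r_sqrt.
have s_r : sigma r = - r.
  have : (sigma r) ^+ 2 = r ^+ 2 by rewrite -rmorphXn r_sqrt /= rmorph_alg.
  move/eqP; rewrite eqf_sqr; case/orP=> /eqP // sr; case/eqP: sigma_neq1.
  apply/eqP/gal_eqP => x _; have [u [v ->]] := coords x.
  by rewrite gal_id linearD !linearZ /= rmorph1 sr.
have memS2 u v : (u%:A + v *: r \in set_S2 r T) =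
    (u == 0) && (v == 1) || (u == 1) && (v \in T).
  rewrite inE; apply/orP/orP => [[/eqP e | /exists_inP[t tT /eqP e]] |].
  - left; have [-> ->] : u = 0 /\ v = 1; rewrite ?eqxx //.
    by apply: inj; rewrite scale0r scale1r add0r.
  - right; have [-> ->] : u = 1 /\ v = t; rewrite ?eqxx //.
    by apply: inj; rewrite scale1r.
  case=> /andP[/eqP-> vT].
    by left; rewrite (eqP vT) scale0r scale1r add0r.
  by right; apply/exists_inP; exists v => //; rewrite scale1r.
have memS' u v : (u%:A + v *: r \in set_S' r T) = (v == 1) && (u \in 0 |: T).
  rewrite inE; apply/exists_inP/andP => [[t tT /eqP e] | [/eqP-> uT]].
    have [-> ->] : u = t /\ v = 1; rewrite ?eqxx //.
    by apply: inj; rewrite scale1r.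
  by exists u => //; rewrite scale1r.
have T0 := sign_repr_neq0 T_repr.
have repr_ratio x y : y != 0 -> exists2 t, t \in 0 |: T & (t * y) ^+ 2 = x ^+ 2.
  move=> y0; have [t tT e] := sign_repr_exists T_repr (x / y).
  by exists t; rewrite // exprMn e -exprMn divfK.
have onto n : exists u v : F, u ^+ 2 - c * v ^+ 2 = n.
  exact: norm_form_onto T_repr _ _ c_neq0.
have T_sub t : t \in T -> t \in 0 |: T by rewrite in_setU1 orbC => ->.
split; apply: (represents_nquat_quad dimL c_nonsquare r_sqrt s_r two_neq0 onto).
- move=> a; have [u [v ->]] := coords a.
  rewrite memS2 (quad_notin_base c_nonsquare r_sqrt).
  by case/orP=> /andP[_]; [move/eqP-> | exact: T0]; rewrite ?oner_eq0.
- move=> u v v0; have [->|u0] := eqVneq u 0.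
    by exists 0, 1; rewrite memS2 !eqxx oner_eq0 !mul0r.
  (* 1 + t r has ratio t^-1, so t must represent the inverse ratio v / u. *)
  have [t] := repr_ratio v u u0; rewrite in_setU1; case/predU1P=> [->|tT e].
    by rewrite mul0r expr0n => /esym/eqP; rewrite sqrf_eq0 (negPf v0).
  by exists 1, t; rewrite memS2 eqxx tT orbT T0 // mul1r mulrC.
- move=> u v u' v'; rewrite !memS2.
  case/orP=> /andP[/eqP-> vT]; case/orP=> /andP[/eqP-> v'T].
  + by rewrite (eqP vT) (eqP v'T).
  + move/eqP; rewrite (eqP vT) mul0r mul1r expr1n expr0n /=.
    by rewrite eq_sym oner_eq0.
  + by move/eqP; rewrite (eqP v'T) mul0r mul1r expr1n expr0n /= oner_eq0.
  rewrite !mul1r => /esym.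
  by move/(sign_repr_sqr_inj T_repr (T_sub _ vT) (T_sub _ v'T)).
- move=> a; have [u [v ->]] := coords a.
  by rewrite memS' (quad_notin_base c_nonsquare r_sqrt) => /andP[/eqP-> _];
    rewrite oner_eq0.
- move=> u v v0; have [t tT e] := repr_ratio u v v0.
  by exists t, 1; rewrite memS' eqxx tT oner_eq0 mulr1 e.
move=> u v u' v'; rewrite !memS' => /andP[/eqP-> uT] /andP[/eqP-> u'T].
by rewrite !mulr1 => /(sign_repr_sqr_inj T_repr uT u'T).
Qed.
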